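(* Let $(V_0,E_0)$ and $(V_1,E_1)$ be two graphs with $V_0$ and $V_1$ countable, both satisfying the extension property. Then $(V_0,E_0)$ and $(V_1,E_1)$ are isomorphic.
   Context: A graph is a pair $(V,E)$ where $V$ is a set (of vertices) and $E$ is a set of unordered pairs of distinct vertices (edges); two vertices joined by an edge are adjacent. For a vertex $v$, $N(v)$ denotes the set of vertices adjacent to $v$. A graph $(V,E)$ has the extension property if for any two finite disjoint sets of vertices $A,B\subseteq V$ there exists a vertex $v\in V\setminus(A\cup B)$ such that $A\subseteq N(v)$ and $B\cap N(v)=\emptyset$. Two graphs are isomorphic if there is a bijection between their vertex sets such that two vertices are adjacent in the first graph if and only if their images are adjacent in the second. A set is countable if it has at most as many elements as $\mathbb N$. *)

(* Defs.v *)
From mathcomp Require Import all_boot.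
From mathcomp Require Import boolp classical_sets functions cardinality.

Set Implicit Arguments.
Unset Strict Implicit.
Unset Printing Implicit Defensive.

Local Open Scope classical_set_scope.

(* The vertex set is a whole type. An edge is the set of its two (distinct)
   endpoints, so edges are undirected and loop-free by construction. *)
Record graph := Graph {
  vertex :> Type;
  edges : set (set vertex);
  edgesP : forall e, edges e -> exists x y, x <> y /\ e = [set x; y]
}.

Definition adjacent (G : graph) (x y : G) : Prop := edges [set x; y].

Definition neighbours (G : graph) (v : G) : set G := [set w | adjacent v w].

Definition extension_property (G : graph) : Prop :=
  forall A B : set G, finite_set A -> finite_set B -> A `&` B = set0 ->
  exists v : G, [/\ (~` (A `|` B)) v, A `<=` neighbours v
                  & B `&` neighbours v = set0].

Definition isomorphic (G H : graph) : Prop :=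
  exists f : G -> H,
    bijective f /\ forall x y : G, adjacent x y <-> adjacent (f x) (f y).

(* Main.v *)
Require Import Defs.
From mathcomp Require Import all_boot.
From mathcomp Require Import boolp classical_sets functions cardinality.

Local Open Scope classical_set_scope.

(** This is the back-and-forth argument for the uniqueness of the random
    graph. Finite partial isomorphisms are approximations of the isomorphism
    that is sought. The extension property of the target lets every such
    approximation be extended to one more vertex of the source
    ([extend_forth]): the images of the vertices already treated split into
    those that the new image must be adjacent to and those that it must not
    be adjacent to, and these two finite sets are disjoint. Exchanging the two
    graphs, the same lemma puts one more vertex of the target in the image
    ([extend_back]).

    Both vertex sets inject into [nat], so an increasing sequence of
    approximations can treat, at stage [n], the vertices of code [n] on both
    sides ([extend_stage]). The union of the sequence is a total and
    surjective partial isomorphism, hence the graph of an isomorphism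
    ([isomorphic_of_total]). *)

(** * Adjacency *)

Lemma adjacentC {G : graph} (x y : G) : adjacent x y <-> adjacent y x.
Proof. by rewrite /adjacent setUC. Qed.

Lemma adjacent_irrefl {G : graph} (x : G) : ~ adjacent x x.
Proof.
move=> /edgesP[a [b [neq_ab]]]; rewrite setUid => xE; apply: neq_ab.
by have [-> ->] : [set x] a /\ [set x] b by rewrite xE; split; [left|right].
Qed.

(** * Partial isomorphisms *)

(** A partial isomorphism is encoded by its graph, a set of pairs, so that
    exchanging the roles of [G] and [H] is exchanging the two components. *)
Definition partial_iso {G H : graph} (R : set (G * H)) : Prop :=
  forall x y x' y', R (x, y) -> R (x', y') ->
    (x = x' <-> y = y') /\ (adjacent x x' <-> adjacent y y').

Definition finite_partial_iso {G H : graph} (R : set (G * H)) : Prop :=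
  finite_set R /\ partial_iso R.

Lemma finite_partial_iso_converse {G H : graph} (R : set (G * H)) :
  finite_partial_iso R -> finite_partial_iso R^-1%relation.
Proof.
move=> [finR isoR]; split.
  apply: sub_finite_set (finite_image (fun p => (p.2, p.1)) finR).
  by move=> [y x] /= Rxy; exists (x, y).
move=> y x y' x' Rxy Rxy'.
by have [eqR adjR] := isoR _ _ _ _ Rxy Rxy'; split; apply: iff_sym.
Qed.

(** The new pair has to be compared with the old ones in one direction only,
    as adjacency is symmetric, and it agrees with itself because neither graph
    has a loop. *)
Lemma partial_iso_add {G H : graph} (R : set (G * H)) (x : G) (v : H) :
  partial_iso R ->
  (forall x' y', R (x', y') ->
     [/\ x <> x', v <> y' & adjacent x x' <-> adjacent v y']) ->
  partial_iso ((x, v) |` R).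
Proof.
move=> isoR xvR a b a' b' [[-> ->]|Rab] [[-> ->]|Rab'].
- by split=> //; split=> /adjacent_irrefl.
- by have [nx nv xv] := xvR _ _ Rab'.
- have [nx nv xv] := xvR _ _ Rab; split; first by split=> /esym.
  by split=> /adjacentC/xv/adjacentC.
- exact: isoR.
Qed.

(** * Extending finite partial isomorphisms *)

(** The extension property is applied to the images [A] of the neighbours of
    [x] and the images [B] of its non-neighbours. They are disjoint because
    [R] is injective, and their union is the whole image of [R], so that the
    new vertex lies outside of that image. *)
Lemma extend_forth {G H : graph} (R : set (G * H)) (x : G) :
  extension_property H -> finite_partial_iso R ->
  exists S, [/\ finite_partial_iso S, R `<=` S & exists y, S (x, y)].
Proof.
move=> extH [finR isoR].
have [[y Rxy]|xNR] := pselect (exists y, R (x, y)).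
  by exists R; split=> //; exists y.
pose A := [set p.2 | p in [set p | R p /\ adjacent x p.1]].
pose B := [set p.2 | p in [set p | R p /\ ~ adjacent x p.1]].
have finA : finite_set A.
  by apply: finite_image; apply: sub_finite_set finR => p [].
have finB : finite_set B.
  by apply: finite_image; apply: sub_finite_set finR => p [].
have disjAB : A `&` B = set0.
  apply/seteqP; split=> // z [[[a b] [/= Rab xa] bz] [[a' b'] [/= Rab' xa'] bz']].
  have [[_ inj] _] := isoR _ _ _ _ Rab Rab'.
  by apply: xa'; rewrite -inj // bz bz'.
have [v [vNAB vA vB]] := extH A B finA finB disjAB.
exists ((x, v) |` R); split; last by exists v; left.
- split; first by rewrite finite_setU.
  apply: partial_iso_add => // a b Rab.
  have [xa|xNa] := pselect (adjacent x a).
    have Ab : A b by exists (a, b).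
    split; [by move=> eq_xa; apply: xNR; exists b; rewrite eq_xa | |].
      by move=> eq_vb; apply: vNAB; left; rewrite eq_vb.
    by split=> // _; apply: vA.
  have Bb : B b by exists (a, b).
  split; [by move=> eq_xa; apply: xNR; exists b; rewrite eq_xa | |].
    by move=> eq_vb; apply: vNAB; right; rewrite eq_vb.
  split=> // vb; have : (B `&` neighbours v) b by split.
  by rewrite vB.
- by move=> p Rp; right.
Qed.

Lemma extend_back {G H : graph} (R : set (G * H)) (y : H) :
  extension_property G -> finite_partial_iso R ->
  exists S, [/\ finite_partial_iso S, R `<=` S & exists x, S (x, y)].
Proof.
move=> extG /finite_partial_iso_converse isoR.
have [S [isoS subS [x Syx]]] := extend_forth _ y extG isoR.
exists S^-1%relation; split; first exact: finite_partial_iso_converse.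
- by move=> [a b] Rab; apply: subS.
- by exists x.
Qed.

(** Vertices are addressed by injective codes rather than listed by a
    bijection with [nat], so that only countability is used: a number that is
    the code of no vertex asks for no extension. *)
Lemma extend_stage {G H : graph} (cG : G -> nat) (cH : H -> nat) :
  injective cG -> injective cH ->
  extension_property G -> extension_property H ->
  forall (n : nat) (R : set (G * H)), finite_partial_iso R ->
  exists S, [/\ finite_partial_iso S, R `<=` S,
    forall x, cG x = n -> exists y, S (x, y) &
    forall y, cH y = n -> exists x, S (x, y)].
Proof.
move=> injG injH extG extH n R isoR.
have [S [isoS RS forthS]] : exists S, [/\ finite_partial_iso S, R `<=` S &
    forall x, cG x = n -> exists y, S (x, y)].
  have [[x xn]|nG] := pselect (exists x, cG x = n); last first.
    by exists R; split=> // x xn; case: nG; exists x.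
  have [S [isoS RS Sx]] := extend_forth _ x extH isoR.
  by exists S; split=> // x'; rewrite -xn => /injG->.
have [[y yn]|nH] := pselect (exists y, cH y = n); last first.
  by exists S; split=> // y yn; case: nH; exists y.
have [T [isoT ST Ty]] := extend_back _ y extG isoS.
exists T; split=> //; first exact: subset_trans ST.
- by move=> x /forthS[z Sxz]; exists z; apply: ST.
- by move=> y'; rewrite -yn => /injH->.
Qed.

(** * The limit of the extensions *)

Lemma partial_iso_bigcup {G H : graph} (R : nat -> set (G * H)) :
  (forall n, R n `<=` R n.+1) -> (forall n, partial_iso (R n)) ->
  partial_iso (\bigcup_n R n).
Proof.
move=> incR isoR x y x' y' [m _ Rxy] [n _ Rxy'].
have subR i k : R i `<=` R (k + i).
  by elim: k => [|k IHk] //; apply: subset_trans IHk (incR _).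
apply: (isoR (m + n)); last exact: subR.
by rewrite addnC; apply: subR.
Qed.

Lemma isomorphic_of_total {G H : graph} (R : set (G * H)) :
  partial_iso R ->
  (forall x, exists y, R (x, y)) -> (forall y, exists x, R (x, y)) ->
  isomorphic G H.
Proof.
move=> isoR /choice[f Rf] /choice[g Rg]; exists f; split.
  exists g => [x|y].
    by have [[_ ->]] := isoR _ _ _ _ (Rg (f x)) (Rf x).
  by have [[-> //]] := isoR _ _ _ _ (Rf (g y)) (Rg y).
by move=> x y; have [] := isoR _ _ _ _ (Rf x) (Rf y).
Qed.

Theorem theorem5p1 (G0 G1 : graph)
  (countable_V0 : countable [set: vertex G0])
  (countable_V1 : countable [set: vertex G1])
  (ext0 : extension_property G0)
  (ext1 : extension_property G1) :
  isomorphic G0 G1.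
Proof.
have [c0 inj0] := countable_injP _ countable_V0.
have [c1 inj1] := countable_injP _ countable_V1.
have {}inj0 : injective c0 by move=> x y; apply: inj0; rewrite inE.
have {}inj1 : injective c1 by move=> x y; apply: inj1; rewrite inE.
pose approx := {R : set (G0 * G1) | finite_partial_iso R}.
(* The approximations are bundled with their properties because the choice of
   the next one can only be made, and iterated, for those. *)
have /choice[next nextP] : forall p : nat * approx, exists S : approx,
    [/\ sval p.2 `<=` sval S,
      forall x, c0 x = p.1 -> exists y, sval S (x, y) &
      forall y, c1 y = p.1 -> exists x, sval S (x, y)].
  move=> [n [R isoR]].
  have [S [isoS RS S0 S1]] :=
    extend_stage _ _ inj0 inj1 ext0 ext1 n R isoR.
  by exists (exist _ S isoS).
have iso0 : finite_partial_iso (set0 : set (G0 * G1)) by split=> // ? ? ? ? [].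
pose stage := nat_rect (fun=> approx) (exist _ _ iso0) (fun n R => next (n, R)).
apply: (isomorphic_of_total (\bigcup_n sval (stage n))).
- apply: partial_iso_bigcup => n; first by have [] := nextP (n, stage n).
  by case: (svalP (stage n)).
- move=> x; have [_ /(_ x erefl)[y xy] _] := nextP (c0 x, stage (c0 x)).
  by exists y, (c0 x).+1.
- move=> y; have [_ _ /(_ y erefl)[x xy]] := nextP (c1 y, stage (c1 y)).
  by exists x, (c1 y).+1.
Qed.
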